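(* Let $S$ be a compact Hausdorff space without isolated points, $\varphi:S\to S$ a continuous map, $u\in C(S)$ with $u\not\equiv 0$, and $T:C(S)\to C(S)$ an operator such that $T^*(M(S))$ is separable. If $\varphi^{-1}(\{t\})$ is nowhere dense in $S$ for every $t\in S$, and if $|u|$ is constant on $S$, then $$\|uC_\varphi+T\|=\|u\|_\infty+\|T\|.$$
   Context: $C(S)$ is the Banach space of continuous functions $S\to\mathbb{C}$ with the supremum norm $\|\cdot\|_\infty$. $M(S)=C(S)^*$ is its dual, the space of regular Borel measures on $S$ of finite variation, with the total variation norm; $T^*:M(S)\to M(S)$ is the adjoint of $T$, and separability is with respect to the norm. The weighted composition operator $uC_\varphi:C(S)\to C(S)$ is $uC_\varphi(f)=u\cdot(f\circ\varphi)$. Operators are bounded and linear. *)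

(* Defs.v *)
From HB Require Import structures.
From mathcomp Require Import all_boot all_order all_algebra.
From mathcomp Require Import all_classical all_reals all_analysis.
From mathcomp Require Export complex.

Set Implicit Arguments.
Unset Strict Implicit.
Unset Printing Implicit Defensive.

Import Order.TTheory GRing.Theory Num.Theory.
Import numFieldNormedType.Exports.

Local Open Scope classical_set_scope.
Local Open Scope complex_scope.
Local Open Scope ring_scope.

(* numFieldNormedType only covers abstract fields, not the constructor
   [complex]; this gives R[i] the topology of its modulus. *)
HB.instance Definition _ (R : realType) := NormedModule.copy R[i] R[i]^o.

(* A norm over the scalars R[i] takes its values in R[i] (they are real and
   nonnegative); [rnorm] is the same number as an element of R, where suprema
   exist. *)
Definition rnorm (R : realType) (V : normedModType R[i]) (x : V) : R :=
  complex.Re `|x|.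

Section rnorm.
Variables (R : realType) (V : normedModType R[i]).
Implicit Types x y : V.

Lemma rnormE x : (rnorm x)%:C = `|x|.
Proof. by rewrite /rnorm RRe_real. Qed.

Lemma rnorm_le x (r : R) : (rnorm x <= r) = (`|x| <= r%:C).
Proof. by rewrite -rnormE lecR. Qed.

Lemma rnorm_ge0 x : 0 <= rnorm x.
Proof. by rewrite -lecR rnormE; exact: normr_ge0. Qed.

Lemma rnorm_triangle x y : rnorm (x + y) <= rnorm x + rnorm y.
Proof. by rewrite rnorm_le rmorphD/= !rnormE ler_normD. Qed.

Lemma rnormZ (a : R[i]) x : (rnorm (a *: x))%:C = `|a| * (rnorm x)%:C.
Proof. by rewrite !rnormE normrZ. Qed.

Lemma rnorm0 : rnorm (0 : V) = 0.
Proof. by rewrite /rnorm normr0. Qed.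

Lemma rnorm0_eq0 x : rnorm x = 0 -> x = 0.
Proof.
by move=> x0; apply/eqP; rewrite -normr_eq0 -rnormE x0.
Qed.

Lemma rnorm_continuous : continuous (@rnorm R V).
Proof.
move=> x; apply/cvgrPdist_le => e e0.
have e0' : 0 < e%:C :> R[i] by rewrite ltcR.
have /cvgrPdist_le/(_ _ e0') : y @[y --> x] --> x by exact: cvg_id.
apply: filterS => y xy; rewrite -lecR.
apply: le_trans xy; rewrite -rnormE lecR ler_norml.
have := rnorm_triangle (x - y) y; have := rnorm_triangle (y - x) x.
have -> : rnorm (y - x) = rnorm (x - y) by rewrite /rnorm distrC.
rewrite !subrK => h1 h2.
by rewrite lerBlDr h2 andbT lerNl opprB lerBlDr.
Qed.

End rnorm.

HB.mixin Record isCompactHausdorff S & Topological S := {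
  compact_setT : compact [set: S];
  hausdorff_setT : hausdorff_space S
}.

#[short(type="compactHausdorffType")]
HB.structure Definition CompactHausdorff :=
  {S of Topological S & isCompactHausdorff S}.

(* No A !=set0 is needed: sup set0 is 0. *)
Lemma sup_scale (R : realType) (T : Type) (A : set T) (F : T -> R) (a : R) :
  0 <= a -> has_ubound (F @` A) ->
  sup [set a * F t | t in A] = a * sup (F @` A).
Proof.
move=> a0 [M FM]; have [->|/set0P A0] := eqVneq A set0.
  by rewrite !image_set0 sup0 mulr0.
have [t0 At0] := A0.
have FAub : has_ubound (F @` A) by exists M.
have aub : has_ubound [set a * F t | t in A].
  by exists (a * M) => _ [t At <-]; rewrite ler_wpM2l// FM//; exists t.
apply/eqP; rewrite eq_le; apply/andP; split.
  apply: ge_sup; first by exists (a * F t0); exists t0.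
  by move=> _ [t At <-]; rewrite ler_wpM2l// ub_le_sup//; exists t.
have [a00|an0] := eqVneq a 0.
  rewrite a00 mul0r in aub *; rewrite ub_le_sup//.
  by exists t0 => //; rewrite mul0r.
have {a0 an0}a0 : 0 < a by rewrite lt_def an0.
rewrite mulrC -ler_pdivlMr//; apply: ge_sup; first by exists (F t0); exists t0.
move=> _ [t At <-]; rewrite ler_pdivlMr// mulrC ub_le_sup//.
by exists t.
Qed.

Section C.
Variables (R : realType) (S : compactHausdorffType).

Definition C : Type := continuousType S R[i].

HB.instance Definition _ := gen_eqMixin C.
HB.instance Definition _ := gen_choiceMixin C.

Implicit Types f g : C.

Lemma C_eqP f g : f =1 g -> f = g.
Proof. by move=> fg; apply/continuousEP. Qed.

Lemma C_continuous f : continuous f.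
Proof. exact: cts_fun. Qed.

Lemma C_zero_subproof : continuous (fun _ : S => 0 : R[i]).
Proof. exact: cst_continuous. Qed.

Lemma C_opp_subproof f : continuous (fun s => - f s).
Proof. by move=> s; apply: continuousN; exact: C_continuous. Qed.

Lemma C_add_subproof f g : continuous (fun s => f s + g s).
Proof. by move=> s; apply: continuousD; exact: C_continuous. Qed.

Lemma C_scale_subproof (a : R[i]) f : continuous (fun s => a * f s).
Proof.
move=> s; apply: (@continuousM _ _ (fun=> a)); first exact: cst_continuous.
exact: C_continuous.
Qed.

Definition C_zero : C := mkcts C_zero_subproof.
Definition C_opp f : C := mkcts (@C_opp_subproof f).
Definition C_add f g : C := mkcts (@C_add_subproof f g).
Definition C_scale (a : R[i]) f : C := mkcts (@C_scale_subproof a f).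

Lemma C_addA : associative C_add.
Proof. by move=> f g h; apply: C_eqP => s; exact: addrA. Qed.
Lemma C_addC : commutative C_add.
Proof. by move=> f g; apply: C_eqP => s; exact: addrC. Qed.
Lemma C_add0 : left_id C_zero C_add.
Proof. by move=> f; apply: C_eqP => s; exact: add0r. Qed.
Lemma C_addN : left_inverse C_zero C_opp C_add.
Proof. by move=> f; apply: C_eqP => s; exact: addNr. Qed.

HB.instance Definition _ := GRing.isZmodule.Build C C_addA C_addC C_add0 C_addN.

Lemma C_scaleA (a b : R[i]) f : C_scale a (C_scale b f) = C_scale (a * b) f.
Proof. by apply: C_eqP => s; exact: mulrA. Qed.
Lemma C_scale1 : left_id 1 C_scale.
Proof. by move=> f; apply: C_eqP => s; exact: mul1r. Qed.
Lemma C_scaleDr : right_distributive C_scale +%R.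
Proof. by move=> a f g; apply: C_eqP => s; exact: mulrDr. Qed.
Lemma C_scaleDl f : {morph C_scale^~ f : a b / a + b}.
Proof. by move=> a b; apply: C_eqP => s; exact: mulrDl. Qed.

HB.instance Definition _ :=
  GRing.Zmodule_isLmodule.Build R[i] C C_scaleA C_scale1 C_scaleDr C_scaleDl.

Lemma C_bounded f : has_ubound [set rnorm (f s) | s in setT].
Proof.
have /compact_bounded [M [_ Mf]] : compact [set rnorm (f s) | s in setT].
  apply: continuous_compact compact_setT.
  apply: continuous_subspaceT => s.
  by apply: continuous_comp; [exact: C_continuous|exact: rnorm_continuous].
exists (M + 1) => _ [s _ <-]; apply: le_trans (ler_norm _) _.
by apply: (Mf (M + 1)); [rewrite ltrDl|exists s].
Qed.

Definition C_supnorm f : R := sup [set rnorm (f s) | s in setT].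

Lemma C_supnorm_ub f s : rnorm (f s) <= C_supnorm f.
Proof. by apply: ub_le_sup; [exact: C_bounded|exists s]. Qed.

Lemma C_supnorm_ge0 f : 0 <= C_supnorm f.
Proof.
rewrite /C_supnorm.
have [->|/set0P[_ [s _ _]]] := eqVneq [set rnorm (f s) | s in setT] set0.
  by rewrite sup0.
exact: le_trans (rnorm_ge0 _) (C_supnorm_ub f s).
Qed.

Lemma C_supnorm_le f (r : R) : 0 <= r -> (forall s, rnorm (f s) <= r) ->
  C_supnorm f <= r.
Proof.
move=> r0 fr; rewrite /C_supnorm.
have [->|/set0P f0] := eqVneq [set rnorm (f s) | s in setT] set0.
  by rewrite sup0.
by apply: ge_sup => // _ [s _ <-].
Qed.

Lemma C_supnorm_triangle f g :
  (C_supnorm (f + g))%:C <= (C_supnorm f)%:C + (C_supnorm g)%:C.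
Proof.
rewrite -rmorphD lecR; apply: C_supnorm_le => [|s].
  by rewrite addr_ge0 ?C_supnorm_ge0.
apply: le_trans (rnorm_triangle (f s) (g s)) _.
by apply: lerD; exact: C_supnorm_ub.
Qed.

Lemma C_supnormZ (a : R[i]) f :
  (C_supnorm (a *: f))%:C = `|a| * (C_supnorm f)%:C.
Proof.
rewrite -(rnormE a) -rmorphM; congr (_%:C).
rewrite -sup_scale ?rnorm_ge0 ?C_supnorm_ge0//; last exact: C_bounded.
congr sup; apply: eq_imagel => s _.
by apply: complexI; rewrite rmorphM/= [LHS](rnormZ a (f s)) rnormE.
Qed.

Lemma C_supnorm0_eq0 f : (C_supnorm f)%:C = 0 -> f = 0.
Proof.
move=> /complexI f0; apply: C_eqP => s; apply: rnorm0_eq0.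
by apply/eqP; rewrite eq_le rnorm_ge0 -f0 C_supnorm_ub.
Qed.

HB.instance Definition _ := @Lmodule_isNormed.Build R[i] C
  (fun f => (C_supnorm f)%:C) C_supnorm_triangle C_supnormZ C_supnorm0_eq0.

End C.

Section bounded_operator.
Variables (R : realType) (V W : normedModType R[i]).

Record bounded_operator : Type := BoundedOperator {
  bop_linear :> {linear V -> W};
  bop_bounded : exists M : R[i], forall x, `|bop_linear x| <= M * `|x|
}.

HB.instance Definition _ := gen_eqMixin bounded_operator.
HB.instance Definition _ := gen_choiceMixin bounded_operator.

Implicit Types A B : bounded_operator.

Lemma linear_eqP (f g : {linear V -> W}) : f =1 g -> f = g.
Proof.
case: f g => [f cf] [g cg] /= /funext fg; subst g; congr GRing.Linear.Pack.
case: cf cg => [[[f1 f2]] [f3]] [[[g1 g2]] [g3]].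
by rewrite (Prop_irrelevance f1 g1) (Prop_irrelevance f2 g2)
  (Prop_irrelevance f3 g3).
Qed.

Lemma bop_eqP A B : A =1 B -> A = B.
Proof.
case: A B => [A Ab] [B Bb] /= /linear_eqP AB; subst B.
by rewrite (Prop_irrelevance Ab Bb).
Qed.

Lemma bop_zero_subproof :
  exists M : R[i], forall x, `|(\0 : {linear V -> W}) x| <= M * `|x|.
Proof. by exists 0 => x; rewrite /= normr0 mul0r. Qed.

Lemma bop_opp_subproof A :
  exists M : R[i], forall x, `|(\- A : {linear V -> W}) x| <= M * `|x|.
Proof. by have [M AM] := bop_bounded A; exists M => x; rewrite /= normrN. Qed.

Lemma bop_add_subproof A B :
  exists M : R[i], forall x, `|(A \+ B : {linear V -> W}) x| <= M * `|x|.
Proof.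
have [M AM] := bop_bounded A; have [N BN] := bop_bounded B.
by exists (M + N) => x; rewrite mulrDl (le_trans (ler_normD _ _))// lerD.
Qed.

Lemma bop_scale_subproof (a : R[i]) A :
  exists M : R[i], forall x, `|(a \*: A : {linear V -> W}) x| <= M * `|x|.
Proof.
have [M AM] := bop_bounded A; exists (`|a| * M) => x.
by rewrite /= normrZ -mulrA ler_wpM2l.
Qed.

Definition bop_zero := BoundedOperator bop_zero_subproof.
Definition bop_opp A := BoundedOperator (bop_opp_subproof A).
Definition bop_add A B := BoundedOperator (bop_add_subproof A B).
Definition bop_scale a A := BoundedOperator (bop_scale_subproof a A).

Lemma bop_addA : associative bop_add.
Proof. by move=> A B D; apply: bop_eqP => x; exact: addrA. Qed.
Lemma bop_addC : commutative bop_add.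
Proof. by move=> A B; apply: bop_eqP => x; exact: addrC. Qed.
Lemma bop_add0 : left_id bop_zero bop_add.
Proof. by move=> A; apply: bop_eqP => x; exact: add0r. Qed.
Lemma bop_addN : left_inverse bop_zero bop_opp bop_add.
Proof. by move=> A; apply: bop_eqP => x; exact: addNr. Qed.

HB.instance Definition _ :=
  GRing.isZmodule.Build bounded_operator bop_addA bop_addC bop_add0 bop_addN.

Lemma bop_scaleA (a b : R[i]) A :
  bop_scale a (bop_scale b A) = bop_scale (a * b) A.
Proof. by apply: bop_eqP => x; exact: scalerA. Qed.
Lemma bop_scale1 : left_id 1 bop_scale.
Proof. by move=> A; apply: bop_eqP => x; exact: scale1r. Qed.
Lemma bop_scaleDr : right_distributive bop_scale +%R.
Proof. by move=> a A B; apply: bop_eqP => x; exact: scalerDr. Qed.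
Lemma bop_scaleDl A : {morph bop_scale^~ A : a b / a + b}.
Proof. by move=> a b; apply: bop_eqP => x; exact: scalerDl. Qed.

HB.instance Definition _ := GRing.Zmodule_isLmodule.Build R[i] bounded_operator
  bop_scaleA bop_scale1 bop_scaleDr bop_scaleDl.

Definition opnorm A : R := sup [set rnorm (A x) | x in [set x | `|x| <= 1]].

Lemma opnorm_has_ubound A :
  has_ubound [set rnorm (A x) | x in [set x | `|x| <= 1]].
Proof.
have [M AM] := bop_bounded A; exists (rnorm M) => _ [x /= x1 <-].
rewrite -lecR !rnormE (le_trans (AM x))//.
have Mx : M * `|x| \is Num.real := ger0_real (le_trans (normr_ge0 _) (AM x)).
rewrite (le_trans (real_ler_norm Mx))// normrM normr_id.
by rewrite ler_piMr.
Qed.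

Lemma opnorm_ub A x : `|x| <= 1 -> rnorm (A x) <= opnorm A.
Proof.
by move=> x1; apply: ub_le_sup; [exact: opnorm_has_ubound|exists x].
Qed.

Lemma opnorm_le A (r : R) :
  (forall x, `|x| <= 1 -> rnorm (A x) <= r) -> opnorm A <= r.
Proof.
move=> Ar; apply: ge_sup; last by move=> _ [x /= x1 <-]; exact: Ar.
by exists (rnorm (A 0)), 0 => //=; rewrite normr0.
Qed.

Lemma opnorm_ge0 A : 0 <= opnorm A.
Proof.
by rewrite (le_trans (rnorm_ge0 (A 0)))// opnorm_ub// normr0.
Qed.

Lemma opnorm_triangle A B :
  (opnorm (A + B))%:C <= (opnorm A)%:C + (opnorm B)%:C.
Proof.
rewrite -rmorphD lecR; apply: opnorm_le => x x1.
apply: le_trans (rnorm_triangle (A x) (B x)) _.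
by apply: lerD; exact: opnorm_ub.
Qed.

Lemma opnormZ (a : R[i]) A : (opnorm (a *: A))%:C = `|a| * (opnorm A)%:C.
Proof.
rewrite -(rnormE a) -rmorphM; congr (_%:C).
rewrite -sup_scale ?rnorm_ge0//; last exact: opnorm_has_ubound.
congr sup; apply: eq_imagel => x _.
by apply: complexI; rewrite rmorphM/= [LHS](rnormZ a (A x)) rnormE.
Qed.

Lemma opnorm0_eq0 A : (opnorm A)%:C = 0 -> A = 0.
Proof.
move=> /complexI A0; apply: bop_eqP => x.
have [->|x0] := eqVneq x 0; first by rewrite !linear0.
have nx0 : `|x| != 0 by rewrite normr_eq0.
have : rnorm (A (`|x|^-1 *: x)) <= 0.
  by rewrite -A0 opnorm_ub// normrZ normfV normr_id mulVf.
rewrite le_eqVlt ltNge rnorm_ge0 orbF => /eqP/rnorm0_eq0/eqP.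
by rewrite linearZ/= scaler_eq0 invr_eq0 (negbTE nx0) => /eqP.
Qed.

HB.instance Definition _ := @Lmodule_isNormed.Build R[i] bounded_operator
  (fun A => (opnorm A)%:C) opnorm_triangle opnormZ opnorm0_eq0.

End bounded_operator.

(* For V := C R S this is M(S): by the Riesz theorem, regular complex Borel
   measures on S with the total variation norm. *)
Definition dual (R : realType) (V : normedModType R[i]) :=
  bounded_operator V R[i].

HB.instance Definition _ (R : realType) (V : normedModType R[i]) :=
  NormedModule.on (dual V).

Section adjoint.
Variables (R : realType) (V W : normedModType R[i]).
Variable T : bounded_operator V W.

Lemma adjoint_subproof (mu : dual W) :
  exists M : R[i], forall x, `|(mu \o T : {linear V -> R[i]}) x| <= M * `|x|.
Proof.
have [M TM] := bop_bounded T; have [N muN] := bop_bounded mu.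
exists (`|N| * `|M|) => x; rewrite /= (le_trans (muN _))//.
have [/eqP|Tx0] := eqVneq `|T x| 0.
  by move=> /eqP ->; rewrite mulr0 !mulr_ge0.
have Tx_gt0 : 0 < `|T x| by rewrite lt_def Tx0 normr_ge0.
have Nreal : N * `|T x| \is Num.real.
  by rewrite ger0_real// (le_trans (normr_ge0 _) (muN _)).
rewrite (le_trans (real_ler_norm Nreal))// normrM normr_id -mulrA ler_wpM2l//.
rewrite (le_trans (TM x))//.
have Mreal : M * `|x| \is Num.real.
  by rewrite ger0_real// (le_trans (normr_ge0 _) (TM _)).
by rewrite (le_trans (real_ler_norm Mreal))// normrM normr_id.
Qed.

Definition adjoint (mu : dual W) : dual V :=
  BoundedOperator (adjoint_subproof mu).

End adjoint.

Section weighted_composition.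
Variables (R : realType) (S : compactHausdorffType).
Variables (u : C R S) (phi : continuousType S S).

Lemma wcomp_fun_subproof (f : C R S) : continuous (fun s => u s * f (phi s)).
Proof.
move=> s; apply: continuousM; first exact: C_continuous.
by apply: continuous_comp; [exact: cts_fun|exact: C_continuous].
Qed.

Definition wcomp_fun (f : C R S) : C R S := mkcts (@wcomp_fun_subproof f).

Lemma wcomp_fun_linear : linear wcomp_fun.
Proof.
move=> a f g; apply: C_eqP => s /=.
rewrite -[LHS]/(u s * (a * f (phi s) + g (phi s))).
rewrite -[RHS]/(a * (u s * f (phi s)) + u s * g (phi s)).
by rewrite mulrDr mulrCA.
Qed.

HB.instance Definition _ :=
  GRing.isLinear.Build R[i] (C R S) (C R S) *:%R wcomp_fun wcomp_fun_linear.

Lemma wcomp_bounded : exists M : R[i], forall f, `|wcomp_fun f| <= M * `|f|.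
Proof.
exists `|u| => f; rewrite -[X in _ <= X * _]rnormE -[X in _ <= _ * X]rnormE.
rewrite -rmorphM lecR; apply: C_supnorm_le => [|s].
  by rewrite mulr_ge0 ?rnorm_ge0.
rewrite -lecR rnormE normrM rmorphM/=.
by rewrite ler_pM// -rnormE lecR; exact: C_supnorm_ub.
Qed.

Definition wcomp : bounded_operator (C R S) (C R S) :=
  BoundedOperator wcomp_bounded.

End weighted_composition.

Definition nowhere_dense (T : topologicalType) (A : set T) :=
  interior (closure A) = set0.

Definition separable_set (T : topologicalType) (A : set T) :=
  exists D : set T, [/\ countable D, D `<=` A & A `<=` closure D].

(* Main.v *)
(** ||uC_phi + T|| is tested at points s: the functional there is
    u(s) delta_(phi s) + mu_s with mu_s = T^* delta_s, and its norm is
    |u(s)| + ||mu_s|| as soon as mu_s has no mass at phi s. Functionals in a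
    separable subset of M(S) have together only countably many atoms, and the
    preimages of these under phi are nowhere dense, so by Baire they cannot fill
    the open set of the s where |(T f)(s)| is close to ||T||. Modifying f on a
    small neighbourhood of phi s then aligns the two summands. *)

Require Import Defs.
From HB Require Import structures.
From mathcomp Require Import all_boot all_order all_algebra.
From mathcomp Require Import all_classical all_reals all_analysis.
From mathcomp Require Import lra.

Set Implicit Arguments.
Unset Strict Implicit.
Unset Printing Implicit Defensive.

Import Order.TTheory GRing.Theory Num.Theory.
Import numFieldNormedType.Exports.

Local Open Scope classical_set_scope.
Local Open Scope ring_scope.

(** * Baire category in compact Hausdorff spaces *)

Lemma compact_hausdorff_Baire (S : compactHausdorffType) (I : Type)
    (D : set I) (F : I -> set S) (U : set S) :
  countable D -> (forall i, D i -> nowhere_dense (F i)) ->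
  open U -> U !=set0 -> exists2 s, U s & forall i, D i -> ~ F i s.
Proof.
move=> /countable_injP[r r_inj] Fnd Uo U0.
(* As [r] is injective on [D], at most one set has index n. The interior of its closure is empty, so
   A has a point off that closure, and regularity shrinks A around this point. *)
have step (n : nat) (A : {A : set S | open A /\ A !=set0}) :
    exists B : {B : set S | open B /\ B !=set0},
    closure (sval B) `<=` sval A /\
    forall i, D i -> r i = n -> closure (sval B) `&` F i = set0.
  case: A => A [/= Ao A0].
  have [x Ax xF] : exists2 x, A x &
      forall i, D i -> r i = n -> nbhs x (~` F i).
    have [[i [Di rin]]|noi] := pselect (exists i, D i /\ r i = n); last first.
      by have [x Ax] := A0; exists x => // i Di rin; case: noi; exists i.
    have [x Ax xF] : exists2 x, A x & ~ closure (F i) x.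
      apply: contrapT => noi; have [x Ax] := A0.
      suff : interior (closure (F i)) x by rewrite (Fnd _ Di).
      move: (open_nbhs_nbhs (conj Ao Ax)); apply: filterS => y Ay.
      by apply: contrapT => yF; apply: noi; exists y.
    exists x => // j Dj rjn.
    have -> : j = i by apply: r_inj; rewrite ?inE// rjn.
    have : nbhs x (~` closure (F i)).
      apply: open_nbhs_nbhs; split => //.
      by apply: closed_openC; exact: closed_closure.
    by apply: filterS; apply: subsetC; exact: subset_closure.
  have [W Wx WF] : exists2 W, nbhs x W &
      W `<=` A /\ forall i, D i -> r i = n -> W `<=` ~` F i.
    exists (A `&` \bigcap_(i in [set i | D i /\ r i = n]) ~` F i).
      apply: filterI; first exact: open_nbhs_nbhs.
      have [[i [Di rin]]|noi] := pselect (exists i, D i /\ r i = n).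
        move: (xF _ Di rin); apply: filterS => y yF j [Dj rjn].
        by have -> : j = i by apply: r_inj; rewrite ?inE// rjn.
      by apply: filterS filterT => y _ i ?; case: noi; exists i.
    by split=> [y [] //|i Di rin y [_]]; apply; split.
  have [B Bx BW] := compact_regular (hausdorff_setT (s:=S))
    (compact_setT (s:=S)) (filterT : nbhs x setT) Wx.
  have BoB : closure (interior B) `<=` closure B.
    by apply: closureS; exact: interior_subset.
  have Bo : open (interior B) /\ interior B !=set0.
    by split; [exact: open_interior|exists x].
  exists (exist _ (interior B) Bo); split => /= [|i Di rin].
    by apply: subset_trans BoB (subset_trans BW WF.1).
  by rewrite -subset0 => y [/BoB/BW/(WF.2 _ Di rin)].
have /choice[g gP] : forall nA : nat * {A : set S | open A /\ A !=set0},
    exists B : {B : set S | open B /\ B !=set0},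
    closure (sval B) `<=` sval nA.2 /\
    forall i, D i -> r i = nA.1 -> closure (sval B) `&` F i = set0.
  by case=> n A; exact: step.
(* The shift by one: the closure of [V n.+1] misses the set of index n. *)
pose V := fix V n := if n is m.+1 then g (m, V m) else exist _ U (conj Uo U0).
have Vclosure n : closure (sval (V n.+1)) `<=` sval (V n) := (gP (n, V n)).1.
have Vanti m n : (m <= n)%N -> sval (V n) `<=` sval (V m).
  move=> /subnK <-; elim: (n - m)%N => // k IH; rewrite addSn.
  apply: subset_trans IH; apply: subset_trans (Vclosure _).
  exact: subset_closure.
pose G := filter_from [set: nat] (fun n => sval (V n)).
have GP : ProperFilter G.
  apply: filter_from_proper => [|n _]; last by case: (V n) => ? [].
  apply: filter_from_filter; first by exists 0%N.
  move=> m n _ _; exists (maxn m n) => // x Vx.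
  by split; apply: Vanti Vx; rewrite ?leq_maxl ?leq_maxr.
(* A cluster point of the nested sets lies in all their closures, hence in [U] and off every
   [F i]. *)
have [s [_ sG]] : setT `&` cluster G !=set0.
  by apply: (compact_setT (s:=S)); exact: filterT.
have sV n : closure (sval (V n)) s.
  by move: sG; rewrite clusterE; apply; exists n.
exists s => [|i Di Fs]; first exact: (Vclosure 0%N).
have /seteqP[/(_ s)+ _] := (gP (r i, V (r i))).2 i Di erefl.
by apply; split => //; exact: (sV (r i).+1).
Qed.

Local Open Scope complex_scope.

(** * Real-valued norms, phases and point evaluations *)

Section sup_norm.
Variables (R : realType) (S : compactHausdorffType).
Implicit Types (f g : C R S) (s t : S).

Lemma rnormM (a b : R[i]) : rnorm (a * b) = rnorm a * rnorm b.
Proof. by apply: complexI; rewrite rmorphM/= !rnormE normrM. Qed.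

Lemma rnormC (r : R) : rnorm (r%:C : R[i]) = `|r|.
Proof.
by apply: complexI; rewrite rnormE normc_def/= expr0n addr0 sqrtr_sqr.
Qed.

Lemma rnorm1_le (V : normedModType R[i]) (x : V) : (`|x| <= 1) = (rnorm x <= 1).
Proof. by rewrite rnorm_le. Qed.

Lemma rnorm_phase (z : R[i]) :
  exists2 a : R[i], rnorm a = 1 & a * z = (rnorm z)%:C.
Proof.
have [->|z0] := eqVneq z 0.
  by exists 1; rewrite ?mulr0 ?rnorm0// -[1]/(1%:C) rnormC normr1.
have nz0 : `|z| != 0 by rewrite normr_eq0.
exists (`|z| / z); last by rewrite divfK// rnormE.
by apply: complexI; rewrite rnormE normrM normfV normr_id mulfV.
Qed.

Lemma C_le_rnorm f s : rnorm (f s) <= rnorm f.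
Proof. exact: C_supnorm_ub. Qed.

Lemma C_rnorm_le f (r : R) : 0 <= r -> (forall s, rnorm (f s) <= r) ->
  rnorm f <= r.
Proof. exact: C_supnorm_le. Qed.

Definition eval_at s (f : C R S) : R[i] := f s.

Lemma eval_at_linear s : linear (eval_at s).
Proof. by []. Qed.

HB.instance Definition _ s :=
  GRing.isLinear.Build R[i] (C R S) R[i] *:%R (eval_at s) (eval_at_linear s).

Lemma eval_at_bounded s : exists M : R[i], forall f, `|eval_at s f| <= M * `|f|.
Proof.
by exists 1 => f; rewrite mul1r -!rnormE lecR; exact: C_le_rnorm.
Qed.

Definition dirac_dual s : dual (C R S) := BoundedOperator (eval_at_bounded s).

Lemma rnormN (V : normedModType R[i]) (x : V) : rnorm (- x) = rnorm x.
Proof. by rewrite /rnorm normrN. Qed.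

Lemma rnorm_scale (V : normedModType R[i]) (a : R[i]) (x : V) :
  rnorm (a *: x) = rnorm a * rnorm x.
Proof. by apply: complexI; rewrite rnormZ rmorphM/= rnormE. Qed.

Lemma bop_le_rnorm (V W : normedModType R[i]) (A : bounded_operator V W) x :
  rnorm (A x) <= rnorm A * rnorm x.
Proof.
have [->|x0] := eqVneq x 0; first by rewrite linear0 !rnorm0 mulr0.
have x_gt0 : 0 < rnorm x.
  rewrite lt_def rnorm_ge0 andbT; apply: contra x0 => /eqP/rnorm0_eq0 ->//.
have ninv : rnorm ((rnorm x)^-1%:C : R[i]) = (rnorm x)^-1.
  by rewrite rnormC ger0_norm// invr_ge0 ltW.
rewrite -ler_pdivrMr// mulrC -ninv -rnorm_scale -linearZ.
by apply: opnorm_ub; rewrite rnorm1_le rnorm_scale ninv mulVf// gt_eqF.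
Qed.

Lemma bop_rnorm_le (V W : normedModType R[i]) (A : bounded_operator V W)
    (r : R) :
  (forall x, rnorm x <= 1 -> rnorm (A x) <= r) -> rnorm A <= r.
Proof. by move=> Ar; apply: opnorm_le => x; rewrite rnorm1_le; exact: Ar. Qed.

End sup_norm.

(** * Atoms of functionals on [C R S] *)

Section atoms.
Variables (R : realType) (S : compactHausdorffType).
Implicit Types (f g : C R S) (s t : S) (nu mu : dual (C R S)) (e : R).

(* For the measure nu this says |nu|(V) > e for every open V containing t, hence
   |nu|({t}) >= e; so |nu|({t}) = 0 iff has_atom nu e t fails for all e > 0. *)
Definition has_atom nu e t := forall V, open V -> V t ->
  exists f, [/\ rnorm f <= 1, forall s, ~ V s -> f s = 0 & e < rnorm (nu f)].

(** The same test functions serve for [mu]: on the unit ball the two functionals differ by at most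
    e'. *)
Lemma has_atom_near nu mu e e' t :
  has_atom nu (e + e') t -> rnorm (nu - mu) <= e' -> has_atom mu e t.
Proof.
move=> nut numu V Vo Vt; have [f [f1 fV nuf]] := nut V Vo Vt.
exists f; split => //; rewrite -(ltrD2r e') (lt_le_trans nuf)//.
have -> : nu f = mu f + (nu - mu) f.
  by rewrite -[(nu - mu) f]/(nu f - mu f) addrCA subrr addr0.
rewrite (le_trans (rnorm_triangle _ _))// lerD2l.
rewrite (le_trans (bop_le_rnorm _ _))//.
by rewrite (le_trans _ numu)// ler_piMr ?rnorm_ge0.
Qed.

(** Bumps at distinct atoms can be given disjoint supports, so their sum stays in the unit ball, and
    phases that make their values nonnegative exclude cancellation. The closed set [F] lets the
    induction keep room for the next bump. *)
Lemma atoms_test_function nu e (l : seq S) (F : set S) : 0 <= e ->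
  uniq l -> (forall t, t \in l -> has_atom nu e t) ->
  closed F -> (forall t, t \in l -> ~ F t) ->
  exists f (r : R), [/\ rnorm f <= 1, forall s, F s -> f s = 0,
    nu f = r%:C & e *+ size l <= r].
Proof.
move=> e0; elim: l F => [|t l IH] F /=.
  move=> _ _ _ _; exists 0, 0; split => //; first by rewrite rnorm0.
  by rewrite linear0.
move=> /andP[tl ul] at_l Fc Fl.
have K_closed : closed (F `|` [set` l]).
  apply: closedU => //.
  have S_T1 := hausdorff_accessible (hausdorff_setT (s:=S)).
  apply: (accessible_finite_set_closed.1 S_T1).
  exact: finite_seq.
have Kt : ~ (F `|` [set` l]) t.
  move=> [|/=]; first exact/Fl/mem_head.
  by rewrite (negPf tl).
(* The new bump will live in [B], whose closure misses [F] and the other atoms; the function from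
   the induction has to vanish on that closure. *)
have [B Bt BK] := compact_regular (hausdorff_setT (s:=S))
  (compact_setT (s:=S)) (filterT : nbhs t setT)
  (open_nbhs_nbhs (conj (closed_openC K_closed) Kt)).
have [f [r [f1 fF nuf er]]] : exists f (r : R), [/\ rnorm f <= 1,
    forall s, (F `|` closure B) s -> f s = 0,
    nu f = r%:C & e *+ size l <= r].
  apply: IH => //.
  - by move=> s sl; apply: at_l; rewrite inE sl orbT.
  - by apply: closedU => //; exact: closed_closure.
  - move=> s sl [Fs|/BK]; first by apply: Fl Fs; rewrite inE sl orbT.
    by apply; right.
have [g [g1 gB nug]] := at_l t (mem_head _ _) _ (open_interior B)
  (nbhs_singleton (nbhs_interior Bt)).
have gB' s : ~ closure B s -> g s = 0.
  by move=> Bs; apply: gB => /interior_subset/subset_closure.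
have [a a1 anu] := rnorm_phase (nu g).
exists (f + a *: g), (r + rnorm (nu g)); split.
- apply: C_rnorm_le => // s.
  rewrite -[(f + a *: g) s]/(f s + a * g s).
  have [Bs|Bs] := pselect (closure B s).
    rewrite fF; last by right.
    rewrite add0r rnormM a1 mul1r; exact: le_trans (C_le_rnorm _ _) g1.
  rewrite gB'// mulr0 addr0; exact: le_trans (C_le_rnorm _ _) f1.
- move=> s Fs; rewrite -[(f + a *: g) s]/(f s + a * g s).
  rewrite fF; last by left.
  by rewrite gB' ?mulr0 ?addr0// => /BK; apply; left.
- by rewrite linearD linearZ/= nuf [_ *: _]anu rmorphD.
- by rewrite mulrS addrC lerD// ltW.
Qed.

(** With n atoms, a function in the unit ball has value at least n e under [nu], which is absurd
    once n e exceeds the norm of [nu]. *)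
Lemma atoms_finite nu e : 0 < e -> finite_set [set t | has_atom nu e t].
Proof.
move=> e0; apply: contrapT => inf.
have [n nnu] : exists n : nat, rnorm nu < e *+ n.
  exists (Num.truncn (rnorm nu / e)).+1.
  by rewrite -[_ *+ _]mulr_natr -ltr_pdivrMl// mulrC truncnS_gt.
have [B /(_ _)Bat nB] := infinite_set_fset n inf.
have [|||||f [r [f1 _ nuf er]]] :=
  @atoms_test_function nu e (finmap.enum_fset B) set0.
- exact: ltW.
- exact: finmap.fset_uniq.
- by move=> t tB; exact: Bat.
- exact: closed0.
- by move=> t _ [].
have := bop_le_rnorm nu f; rewrite nuf rnormC.
apply/negP; rewrite -ltNge.
have enr : e *+ n <= r by rewrite (le_trans _ er)// ler_wpMn2l// ltW.
rewrite (lt_le_trans _ (ler_norm r))// (lt_le_trans _ enr)//.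
by rewrite (le_lt_trans _ nnu)// ler_piMr ?rnorm_ge0.
Qed.

Lemma atoms_countable nu :
  countable (\bigcup_k [set t | has_atom nu k.+1%:R^-1 t]).
Proof.
apply: bigcup_countable => // k _; apply: finite_set_countable.
by apply: atoms_finite; rewrite invr_gt0 ltr0n.
Qed.

(** An atom of [nu] at level e persists at level e / 2 in any functional within e / 2 of [nu], in
    particular in a member of the countable dense set. *)
Lemma separable_atoms (A : set (dual (C R S))) : separable_set A ->
  exists2 P : set S, countable P &
    forall nu e t, A nu -> 0 < e -> has_atom nu e t -> P t.
Proof.
move=> [D [Dc DA AD]].
exists (\bigcup_(nu in D) \bigcup_k [set t | has_atom nu k.+1%:R^-1 t]).
  by apply: bigcup_countable => // nu _; exact: atoms_countable.
move=> nu e t Anu e0 nut.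
have e20 : 0 < e / 2 by rewrite divr_gt0.
have [mu [Dmu numu]] : (D `&` [set mu | rnorm (nu - mu) <= e / 2]) !=set0.
  apply: (AD _ Anu); have e2C : 0 < (e / 2)%:C :> R[i] by rewrite ltcR.
  have /cvgrPdist_le/(_ _ e2C) : y @[y --> nu] --> nu by exact: cvg_id.
  by apply: filterS => y; rewrite -rnormE lecR.
(* This k satisfies k + 1 > (e / 2)^-1, so the level 1 / (k + 1) is below e / 2. *)
exists mu => //; exists (Num.truncn (e / 2)^-1) => //=.
have mut : has_atom mu (e / 2) t.
  by apply: (has_atom_near (nu := nu) (e' := e / 2)) => //; rewrite -splitr.
move=> V Vo Vt; have [f [f1 fV muf]] := mut V Vo Vt.
exists f; split => //; apply: le_lt_trans muf.
rewrite -[leRHS]invrK lef_pV2 ?posrE ?ltr0n ?invr_gt0//.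
by rewrite ltW// truncnS_gt.
Qed.

End atoms.

(** * Prescribing the value of a function at one point *)

Section peak.
Variables (R : realType) (S : compactHausdorffType).
Implicit Types (f : C R S) (s t : S) (V : set S).

Lemma real_complex_continuous : continuous (fun r : R => r%:C : R[i]).
Proof.
move=> x; apply/cvgrPdist_le => e e0.
have re0 : 0 < complex.Re e by case: e e0 => a b /=; rewrite ltcE /= => /andP[].
have eE : e = (complex.Re e)%:C.
  by case: e e0 {re0} => a b /=; rewrite ltcE /= => /andP[/eqP -> _].
have /cvgrPdist_le/(_ _ re0) : y @[y --> x] --> x by exact: cvg_id.
apply: filterS => y xy.
by rewrite -rmorphB -rnormE rnormC eE lecR.
Qed.

(* Replacing f by (1 - h) f + h a, for a bump function h at t supported in V. *)
Lemma peak_modification f t V (a : R[i]) : open V -> V t ->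
  rnorm f <= 1 -> rnorm a <= 1 ->
  exists g : C R S, [/\ rnorm g <= 1, g t = a & forall s, ~ V s -> g s = f s].
Proof.
move=> Vo Vt f1 a1.
have tc : closed [set t].
  have S_T1 := hausdorff_accessible (hausdorff_setT (s:=S)).
  exact: (accessible_finite_set_closed.1 S_T1).
have Vt0 : ~` V `&` [set t] = set0.
  by rewrite -subset0 => x [/= + xt]; rewrite xt.
have /(normal_separatorP (R:=R)).1/(_ _ _ (open_closedC Vo) tc Vt0) :=
  compact_normal (hausdorff_setT (s:=S)) (compact_setT (s:=S)).
move=> /(@uniform_separatorP _ R)[h [hc h01 hV ht]].
have gc : continuous (fun s => f s + (h s)%:C * (a - f s)).
  move=> s; apply: continuousD; first exact: C_continuous.
  apply: continuousM.
    by apply: continuous_comp; [exact: hc|exact: real_complex_continuous].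
  by apply: continuousB; [exact: cst_continuous|exact: C_continuous].
have gE s : (mkcts gc : C R S) s = f s + (h s)%:C * (a - f s) by [].
exists (mkcts gc); split.
- apply: C_rnorm_le => // s; rewrite gE.
  have : (h s) \in `[0, 1] by apply: h01; exists s.
  rewrite in_itv/= => /andP[h0 h1].
  (* Written as a convex combination, the value visibly has modulus at most 1. *)
  have -> : f s + (h s)%:C * (a - f s) = (1 - h s)%:C * f s + (h s)%:C * a.
    by rewrite rmorphB rmorph1 mulrBl mul1r mulrBr addrA addrAC.
  rewrite (le_trans (rnorm_triangle _ _))// !rnormM !rnormC.
  rewrite !ger0_norm ?subr_ge0//.
  rewrite -[leRHS](subrK (h s)) lerD//.
    by rewrite ler_piMr ?subr_ge0// (le_trans (C_le_rnorm _ _)).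
  by rewrite ler_piMr.
- rewrite gE; have -> : h t = 1 by apply: ht; exists t.
  by rewrite rmorph1 mul1r addrCA subrr addr0.
- move=> s Vs; rewrite gE; have -> : h s = 0 by apply: hV; exists s.
  by rewrite rmorph0 mul0r addr0.
Qed.

End peak.

(** * The norm of the sum [wcomp u phi + T] *)

Lemma exists_near_norm (R : realType) (S : compactHausdorffType) (s0 : S)
    (T : bounded_operator (C R S) (C R S)) (e : R) : 0 < e ->
  exists f s, rnorm f <= 1 /\ rnorm T - e < rnorm (T f s).
Proof.
move=> e0; apply: contrapT => noi.
have le f s : rnorm f <= 1 -> rnorm (T f s) <= rnorm T - e.
  by move=> f1; rewrite leNgt; apply/negP => Tfs; apply: noi; exists f, s.
(* [C_rnorm_le] asks for a nonnegative bound; evaluating [T 0] at [s0] provides it. *)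
have T0 : 0 <= rnorm T - e.
  by apply: (le_trans (rnorm_ge0 (T 0 s0))); apply: le; rewrite rnorm0.
have : rnorm T <= rnorm T - e.
  by apply: bop_rnorm_le => f f1; apply: C_rnorm_le => // s; exact: le.
by rewrite lerBrDr gerDl leNgt e0.
Qed.

Local Close Scope complex_scope.

Theorem theorem2p14 (R : realType) (S : compactHausdorffType)
    (phi : continuousType S S) (u : C R S)
    (T : bounded_operator (C R S) (C R S))
    (noisolated : isolated [set: S] = set0)
    (u_neq0 : u <> 0)
    (T_sep : separable_set (range (adjoint T)))
    (phi_nowhere_dense : forall t : S, nowhere_dense (phi @^-1` [set t]))
    (u_const : exists c : R[i], forall s : S, `|u s| = c) :
  `|wcomp u phi + T| = `|u| + `|T|.
Proof.
have [s0 _] : exists s0 : S, u s0 != 0.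
  apply: contrapT => u0; apply: u_neq0; apply: C_eqP => s.
  by have [//|us] := eqVneq (u s) 0; case: u0; exists s.
(* The weight has full modulus everywhere, so the test point may be chosen for [T] alone. *)
have uE s : rnorm (u s) = rnorm u.
  apply/eqP; rewrite eq_le C_le_rnorm/=; apply: C_rnorm_le => [|t].
    exact: rnorm_ge0.
  by have [c uc] := u_const; rewrite /rnorm !uc.
rewrite -!rnormE -rmorphD; congr (real_complex R _); apply/eqP.
rewrite eq_le; apply/andP; split.
  rewrite (le_trans (rnorm_triangle _ _))// lerD2r.
  apply: bop_rnorm_le => f f1; apply: C_rnorm_le => [|s].
    exact: rnorm_ge0.
  rewrite -[wcomp _ _ _ _]/(u s * f (phi s)) rnormM uE ler_piMr ?rnorm_ge0//.
  by rewrite (le_trans (C_le_rnorm _ _)).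
have [P Pc Pat] := separable_atoms T_sep.
(* One e is lost in nearly attaining the norm of [T], two more in modifying [f] near [phi s]. *)
suff main e : 0 < e -> rnorm u + rnorm T - e *+ 3 <= rnorm (wcomp u phi + T).
  apply/ler_addgt0Pr => e e0; rewrite -lerBlDr.
  have := main (e / 3).
  rewrite divr_gt0// -[_ *+ 3]mulr_natr divfK ?pnatr_eq0//.
  exact.
move=> e0.
have [f [s1 [f1 Tfs1]]] := exists_near_norm s0 T e0.
have Uo : open [set s | rnorm T - e < rnorm (T f s)].
  apply: (open_comp (f := fun s => rnorm (T f s))
    (D := [set r | rnorm T - e < r])).
    move=> s _; apply: continuous_comp; first exact: C_continuous.
    exact: rnorm_continuous.
  exact: open_gt.
(* Baire, for the fibres of [phi] over [P]: [T f] is still large at s, while [phi s] is outside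
   [P]. *)
have [s /= Tfs Ps] := compact_hausdorff_Baire Pc
  (fun t _ => phi_nowhere_dense t) Uo (ex_intro _ s1 Tfs1).
have nat_s : ~ has_atom (adjoint T (dirac_dual R s)) e (phi s).
  move=> /(Pat _ _ _ _ e0) H; apply: (Ps (phi s)) => //; apply: H.
  by exists (dirac_dual R s).
(* Negating [has_atom] gives a neighbourhood of [phi s] to which mu_s gives mass at most e. *)
have [V [Vo Vs VT]] : exists V, [/\ open V, V (phi s) & forall g : C R S,
    rnorm g <= 1 -> (forall t, ~ V t -> g t = 0) -> rnorm (T g s) <= e].
  apply: contrapT => noV; apply: nat_s => V Vo Vs; apply: contrapT => nog.
  apply: noV; exists V; split => // g g1 gV; rewrite leNgt; apply/negP => Tg.
  by apply: nog; exists g.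
(* The phases a and b turn [T f s] and [u s] into their moduli. So g is made equal to b at [phi s]
   and to a f off [V]. *)
have [a a1 aTf] := rnorm_phase (T f s).
have [b b1 bu] := rnorm_phase (u s).
have af1 : rnorm (a *: f) <= 1 by rewrite rnorm_scale a1 mul1r.
have [|g [g1 gs gV]] := peak_modification Vo Vs af1 (a := b).
  by rewrite b1.
(* The difference g - a f has norm at most 2; halved, it lies in the unit ball and [VT] applies. *)
pose k : C R S := (2^-1 : R)%:C%C *: (g - a *: f).
have k1 : rnorm k <= 1.
  rewrite rnorm_scale rnormC ger0_norm ?invr_ge0// ler_pdivrMl// mulr1.
  rewrite (le_trans (rnorm_triangle _ _))// rnormN.
  by rewrite -[2]/(1 + 1) lerD.
have kV t : ~ V t -> k t = 0.
  move=> Vt; rewrite -[k t]/((2^-1 : R)%:C%C * (g t - (a *: f) t)).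
  by rewrite gV// subrr mulr0.
have gE : g = a *: f + 2 *: k.
  rewrite scalerA -(rmorph_nat (real_complex R)) -rmorphM/= mulfV// scale1r.
  by rewrite addrCA subrr addr0.
have wE : (wcomp u phi + T) g s = (rnorm u + rnorm (T f s))%:C%C + 2 * T k s.
  rewrite -[LHS]/(u s * g (phi s) + T g s) gs mulrC bu uE rmorphD/= -addrA.
  congr +%R; rewrite gE linearD !linearZ/= -aTf.
  by [].
have wg : rnorm ((wcomp u phi + T) g s) <= rnorm (wcomp u phi + T).
  rewrite (le_trans (C_le_rnorm _ _))// (le_trans (bop_le_rnorm _ _))//.
  by rewrite ler_piMr ?rnorm_ge0.
apply: le_trans wg; rewrite wE.
have k2 : rnorm (2 * T k s) <= e *+ 2.
  rewrite rnormM -(rmorph_nat (real_complex R)) rnormC ger0_norm// mulr_natl.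
  by rewrite ler_wMn2r// VT.
have n0 : 0 <= rnorm u + rnorm (T f s) by rewrite addr_ge0 ?rnorm_ge0.
rewrite -lerBrDr.
(* Subtracting the error [2 * T k s] again bounds the aligned sum from above, at a cost of at most 2
   e. *)
have := rnorm_triangle ((rnorm u + rnorm (T f s))%:C%C + 2 * T k s)
  (- (2 * T k s)).
rewrite addrK rnormC ger0_norm// rnormN.
lra.
Qed.
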